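(* Let $M\subset\mathbb{R}^d$ be a compact $C^2$ manifold and let $\phi$ be a flow on $M$ with $C^1$ velocity field $X$. If all fixed points of $\phi$ are hyperbolic, then $\phi$ is efficient.
   Context: $\mathbb{R}^d$ carries the Euclidean norm $\|\cdot\|$, and the distance on $M$ is $\operatorname{dist}(x,y)=\|y-x\|$. $B(x,a)$ is the open ball of radius $a$ centered at $x$. $\operatorname{fix}(\phi)$ is the set of fixed points of $\phi$ (points $\sigma$ with $\phi_t(\sigma)=\sigma$ for all $t$). For $a,b\in\mathbb{R}$, $[a,b]$ denotes the closed interval of real numbers between $a$ and $b$, both for $a\le b$ and for $a>b$. For $I\subset\mathbb{R}$, $\phi_I(x)=\{\phi_t(x):t\in I\}$. $\mathcal{H}^+(\mathbb{R})$ is the set of all increasing homeomorphisms of $\mathbb{R}$ onto itself. $\phi$ is efficient (on $M$) if there is $\delta_*>0$ such that if $0<\delta<\delta_*$, $x\in M\setminus\operatorname{fix}(\phi)$ and $g\in\mathcal{H}^+(\mathbb{R})$ satisfy (i) $\operatorname{dist}(\phi_t(x),\phi_{g(t)}(x))<\delta\|X(\phi_t(x))\|$ for all $t\in\mathbb{R}$ and (ii) $\operatorname{diam}(\phi_{[t,g(t)]}(x))<\delta_*$ for all $t\in\mathbb{R}$, then $\phi_{[t,g(t)]}(x)\subset B(\phi_t(x),\delta\|X(\phi_t(x))\|)$ for all $t\in\mathbb{R}$. *)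

(* Defs.v *)
From mathcomp Require Import all_boot all_order all_algebra.
From mathcomp Require Import all_classical all_reals all_analysis.
From mathcomp Require Import complex.

Set Implicit Arguments.
Unset Strict Implicit.
Unset Printing Implicit Defensive.

Import Order.TTheory GRing.Theory Num.Theory.
Import numFieldNormedType.Exports.

Local Open Scope classical_set_scope.
Local Open Scope ring_scope.

(* Points of R^d are row vectors.  The library norm on 'rV[R]_d is the sup norm;
   it gives the usual topology and differentials, and metric notions use the
   Euclidean norm defined here.  The flow phi (phi t x is phi_t(x)) and the
   vector field X are total functions on R^d of which only the values on M
   are ever constrained or used. *)

Definition eucl_norm (R : realType) (d : nat) (v : 'rV[R]_d) : R :=
  Num.sqrt (\sum_(i < d) v 0 i ^+ 2).

Definition eucl_dist (R : realType) (d : nat) (x y : 'rV[R]_d) : R :=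
  eucl_norm (y - x).

Definition eucl_ball (R : realType) (d : nat) (x : 'rV[R]_d) (a : R) :
  set 'rV[R]_d := [set y | eucl_dist x y < a].

Definition eucl_diam (R : realType) (d : nat) (A : set 'rV[R]_d) : \bar R :=
  ereal_sup [set r | exists x y, [/\ A x, A y & r = (eucl_dist x y)%:E]].

(* In finite dimension, y |-> 'd f y is C^n iff y |-> 'd f y v is C^n for all v. *)
Fixpoint Cn_on (R : realType) (d n : nat) (U : set 'rV[R]_d)
    (f : 'rV[R]_d -> 'rV[R]_d) : Prop :=
  match n with
  | 0%N => forall x, U x -> {for x, continuous f}
  | m.+1 => (forall x, U x -> differentiable f x) /\
            (forall v, Cn_on m U (fun y => 'd f y v))
  end.

(* Slice charts: Phi is a C^2 diffeomorphism from U onto V, with inverse Psi,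
   which carries M `&` U onto V `&` (R^k x {0}). *)
Definition C2_manifold (R : realType) (d k : nat) (M : set 'rV[R]_d) : Prop :=
  (k <= d)%N /\
  forall p, M p -> exists (U V : set 'rV[R]_d) (Phi Psi : 'rV[R]_d -> 'rV[R]_d),
    [/\ open U /\ open V,
        U p,
        Cn_on 2 U Phi /\ Cn_on 2 V Psi,
        (forall x, U x -> V (Phi x) /\ Psi (Phi x) = x) /\
        (forall y, V y -> U (Psi y) /\ Phi (Psi y) = y) &
        forall x, U x ->
          (M x <-> forall i : 'I_d, (k <= i)%N -> Phi x 0 i = 0)].

Definition tangent_space (R : realType) (d : nat) (M : set 'rV[R]_d)
    (p : 'rV[R]_d) : set 'rV[R]_d :=
  [set v | exists gamma : R -> 'rV[R]_d,
    [/\ forall t, M (gamma t), gamma 0 = p &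
        is_derive (0 : R^o) 1 (gamma : R^o -> 'rV[R]_d) v]].

Definition C1_extension (R : realType) (d : nat) (M : set 'rV[R]_d)
    (X : 'rV[R]_d -> 'rV[R]_d) (p : 'rV[R]_d) (F : 'rV[R]_d -> 'rV[R]_d) : Prop :=
  exists U : set 'rV[R]_d,
    [/\ open U, U p, Cn_on 1 U F & forall x, U x -> M x -> F x = X x].

Definition C1_on_manifold (R : realType) (d : nat) (M : set 'rV[R]_d)
    (X : 'rV[R]_d -> 'rV[R]_d) : Prop :=
  forall p, M p -> exists F, C1_extension M X p F.

Definition flow_on (R : realType) (d : nat) (M : set 'rV[R]_d)
    (phi : R -> 'rV[R]_d -> 'rV[R]_d) : Prop :=
  [/\ forall t x, M x -> M (phi t x),
      forall x, M x -> phi 0 x = x,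
      forall s t x, M x -> phi (s + t) x = phi s (phi t x) &
      {within [set: R] `*` M,
        continuous (fun p : R * 'rV[R]_d => phi p.1 p.2)}].

Definition velocity_field (R : realType) (d : nat) (M : set 'rV[R]_d)
    (phi : R -> 'rV[R]_d -> 'rV[R]_d) (X : 'rV[R]_d -> 'rV[R]_d) : Prop :=
  forall x, M x ->
    is_derive (0 : R^o) 1 ((fun t : R => phi t x) : R^o -> 'rV[R]_d) (X x).

Definition fix_points (R : realType) (d : nat) (M : set 'rV[R]_d)
    (phi : R -> 'rV[R]_d -> 'rV[R]_d) : set 'rV[R]_d :=
  [set s | M s /\ forall t, phi t s = s].

(* A is the matrix, in the basis of T_s M formed by the rows of B, of the
   derivative DX(s) : T_s M -> T_s M at a zero s of X, that is, of the
   restriction to T_s M of 'd F s for a local C^1 extension F of X.  Matrices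
   act on row vectors, on the right. *)
Definition linear_part (R : realType) (d m : nat) (M : set 'rV[R]_d)
    (X : 'rV[R]_d -> 'rV[R]_d) (s : 'rV[R]_d)
    (B : 'M[R]_(m, d)) (A : 'M[R]_m) : Prop :=
  [/\ row_free B,
      tangent_space M s = [set v | (v <= B)%MS] &
      exists F, C1_extension M X s F /\
        forall u : 'rV[R]_m, 'd F s (u *m B) = u *m A *m B].

Definition hyperbolic (R : realType) (d : nat) (M : set 'rV[R]_d)
    (X : 'rV[R]_d -> 'rV[R]_d) (s : 'rV[R]_d) : Prop :=
  exists (m : nat) (B : 'M[R]_(m, d)) (A : 'M[R]_m),
    linear_part M X s B A /\
    forall l : R[i], eigenvalue (map_mx (real_complex R) A) l -> complex.Re l != 0.

Definition increasing_homeo (R : realType) (g : R -> R) : Prop :=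
  {homo g : a b / a < b} /\ continuous g /\
  exists h : R -> R, [/\ continuous h, cancel g h & cancel h g].

(* phi_[a, b](x), where [a, b] is the interval between a and b in either order *)
Definition orbit_arc (R : realType) (d : nat)
    (phi : R -> 'rV[R]_d -> 'rV[R]_d) (a b : R) (x : 'rV[R]_d) :
  set 'rV[R]_d :=
  [set phi t x | t in `[Num.min a b, Num.max a b]].

Definition efficient (R : realType) (d : nat) (M : set 'rV[R]_d)
    (phi : R -> 'rV[R]_d -> 'rV[R]_d) (X : 'rV[R]_d -> 'rV[R]_d) : Prop :=
  exists2 dstar : R, 0 < dstar &
    forall (delta : R) (x : 'rV[R]_d) (g : R -> R),
      0 < delta < dstar ->
      (M `\` fix_points M phi) x ->
      increasing_homeo g ->
      (forall t, eucl_dist (phi t x) (phi (g t) x) < delta * eucl_norm (X (phi t x))) ->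
      (forall t, (eucl_diam (orbit_arc phi t (g t) x) < dstar%:E)%E) ->
      forall t, orbit_arc phi t (g t) x `<=`
                eucl_ball (phi t x) (delta * eucl_norm (X (phi t x))).

(* Main.v *)
(** Only the arc at a single time is used: the arc of an orbit from [x] to
    [phi_tau x] lies in the ball of radius [delta * |X x|] as soon as its time
    length [|tau|] is small against the inverse Lipschitz constant of [X], since
    [X] is then almost constant on the arc and the distance to [x] increases
    along it.  So it suffices that a short arc whose end points satisfy
    [|phi_tau x - x| < delta * |X x|] has small time length.  Near a regular
    point [p] this follows from the monotonicity of [<., X p>] along the flow.
    Near a hyperbolic fixed point [p] it follows from a quadratic form [V], found
    by triangularizing [DX(p)] over the complex numbers, whose derivative along
    the flow is at least [c * |y - p|^2]: an arc longer than [T] changes [V] by at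
    least a multiple of [|x - p|^2], whereas its end points differ by at most
    [delta * |X x| <= delta * L * |x - p|], so that [V] changes by at most a
    multiple of [delta * |x - p|^2].  Compactness makes the constants uniform. *)

Require Import Defs.
From mathcomp Require Import all_boot all_order all_algebra.
From mathcomp Require Import all_classical all_reals all_analysis.
From mathcomp Require Import complex ring lra.

Set Implicit Arguments.
Unset Strict Implicit.
Unset Printing Implicit Defensive.

Import Order.TTheory GRing.Theory Num.Theory.
Import numFieldNormedType.Exports.
Local Open Scope classical_set_scope.
Local Open Scope ring_scope.

(** * A quadratic Lyapunov function for a hyperbolic linear map *)

Section complex_facts.
Variable R : rcfType.
Implicit Types z w : R[i].
Import Normc.

Lemma normc_ge0 z : 0 <= normc z.
Proof. by case: z => a b; exact: sqrtr_ge0. Qed.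

Lemma normc_conj z : normc (conjc z) = normc z.
Proof. by case: z => a b /=; rewrite sqrrN. Qed.

Lemma normr_Re_le z : `|complex.Re z| <= normc z.
Proof.
case: z => a b /=; rewrite -sqrtr_sqr ler_wsqrtr //.
by rewrite lerDl sqr_ge0.
Qed.

Lemma normc_real (x : R) : normc (real_complex R x) = `|x|.
Proof. by rewrite /= expr0n/= addr0 sqrtr_sqr. Qed.

Lemma mulc_conj z : z * conjc z = real_complex R (normc z ^+ 2).
Proof.
case: z => a b; simpc; rewrite sqr_sqrtr ?addr_ge0 ?sqr_ge0//.
by rewrite -!expr2; congr Complex; ring.
Qed.

Lemma Re_sum (I : finType) (f : I -> R[i]) :
  complex.Re (\sum_i f i) = \sum_i complex.Re (f i).
Proof. by apply: big_morph => // -[? ?] [? ?]. Qed.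

(* Weighting the diagonal by [sgr (Re (T j j)) * eta ^ (2 j)] makes the
   subdiagonal terms small compared with the diagonal ones. *)
Lemma trig_mx_form n (T : 'M[R[i]]_n) :
  is_trig_mx T -> (forall i, complex.Re (T i i) != 0) ->
  exists (D : 'I_n -> R) (c : R), 0 < c /\ forall u : 'I_n -> R[i],
    c * \sum_i normc (u i) ^+ 2 <=
    complex.Re (\sum_i \sum_j u i * T i j * real_complex R (D j) * conjc (u j)).
Proof.
move=> /is_trig_mxP Ttrig Tdiag.
(* A common positive lower bound for all [|Re (T i i)|]; the [1 +] keeps it meaningful for
   [n = 0]. *)
pose r : R := (1 + \sum_i `|complex.Re (T i i)|^-1)^-1.
pose t : R := \sum_i \sum_j normc (T i j).
have rV_gt0 : 0 < 1 + \sum_i `|complex.Re (T i i)|^-1.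
  by rewrite ltr_pwDl// sumr_ge0// => i _; rewrite invr_ge0.
have r_gt0 : 0 < r by rewrite invr_gt0.
have r_le i : r <= `|complex.Re (T i i)|.
  rewrite -[leRHS]invrK lef_pV2 ?posrE ?invr_gt0 ?normr_gt0//.
  by rewrite (bigD1 i)//= addrCA lerDl addr_ge0// sumr_ge0.
have t_ge0 : 0 <= t by do 2![apply: sumr_ge0 => ? _]; exact: normc_ge0.
have le_t i j : normc (T i j) <= t.
  rewrite /t (bigD1 i)//= (bigD1 j)//= -addrA lerDl addr_ge0//.
    by apply: sumr_ge0 => ? _; exact: normc_ge0.
  by do 2![apply: sumr_ge0 => ? _]; exact: normc_ge0.
(* Chosen so that the total off-diagonal loss [t * n / eta] is at most [r / 2], half of the diagonal
   gain. *)
pose eta : R := 1 + 2 * t * n%:R / r.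
have eta_ge1 : 1 <= eta.
  by rewrite lerDl divr_ge0 ?(ltW r_gt0)// !mulr_ge0.
have eta_gt0 : 0 < eta by exact: lt_le_trans eta_ge1.
pose D (j : 'I_n) : R := Num.sg (complex.Re (T j j)) * eta ^+ (j + j).
exists D, (r / 2); split; first by rewrite divr_gt0.
move=> u.
pose a (i : 'I_n) : R := eta ^+ i * normc (u i).
have a_ge0 i : 0 <= a i by rewrite mulr_ge0 ?normc_ge0// exprn_ge0// ltW.
pose e : R := t / (2 * eta).
have e_ge0 : 0 <= e by rewrite divr_ge0// mulr_ge0// ltW.
(* In the rescaled coordinates [a i], a diagonal term gains at least [r * a i ^+ 2], terms above the
   diagonal vanish, and those below are absorbed into squares by
   [2 * a i * a j <= a i ^+ 2 + a j ^+ 2]. *)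
have term i j : (if i == j then r * a i ^+ 2 else 0)
    - e * (a i ^+ 2 + a j ^+ 2) <=
    complex.Re (u i * T i j * real_complex R (D j) * conjc (u j)).
  have [<-|neq_ij] := eqVneq i j.
    have -> : complex.Re (u i * T i i * real_complex R (D i) * conjc (u i)) =
        `|complex.Re (T i i)| * a i ^+ 2.
      rewrite mulrAC [_ * T i i]mulrC -!mulrA [X in T i i * X]mulrA mulc_conj.
      rewrite -rmorphM/= /a exprMn -exprM muln2 -addnn.
      rewrite /D normrEsg; case: (T i i) => x y; simpc => /=; ring.
    rewrite lerBlDr; apply: ler_wpDr; first by rewrite mulr_ge0 ?addr_ge0 ?sqr_ge0.
    by rewrite ler_wpM2r ?sqr_ge0.
  rewrite sub0r.
  have [lt_ij|le_ji] := ltnP i j.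
    rewrite Ttrig// mulr0 !mul0r /= oppr_le0.
    by rewrite mulr_ge0 ?addr_ge0 ?sqr_ge0.
  have lt_ji : (j < i)%N.
    by rewrite ltn_neqAle le_ji andbT eq_sym.
  apply: le_trans (lerNnormlW (normr_Re_le _)).
  rewrite lerN2 !normcM normc_conj normc_real normrM normr_sg Tdiag mul1r.
  rewrite (ger0_norm (exprn_ge0 _ (ltW eta_gt0))).
  apply: (@le_trans _ _ (t / eta * (a i * a j))); last first.
    have -> : t / eta = 2 * e by rewrite /e; field; rewrite gt_eqF.
    rewrite -subr_ge0 [leRHS](_ : _ = e * (a i - a j) ^+ 2); last by ring.
    by rewrite mulr_ge0// sqr_ge0.
  (* The gain of a factor [eta] comes from [j < i]: the weight exponent [j + j] is at most
     [i.-1 + j], one less than the exponent in [a i * a j]. *)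
  have -> : t / eta * (a i * a j) =
      t * (eta ^+ (i.-1 + j) * normc (u i) * normc (u j)).
    rewrite /a -[in eta ^+ i](prednK (leq_ltn_trans (leq0n j) lt_ji)) exprS exprD.
    by field; rewrite gt_eqF.
  rewrite [leLHS](_ : _ = normc (T i j) *
    (eta ^+ (j + j) * normc (u i) * normc (u j))); last by ring.
  apply: ler_pM; rewrite ?normc_ge0 ?le_t//.
    by rewrite !mulr_ge0 ?normc_ge0// exprn_ge0// ltW.
  do 2![apply: ler_wpM2r; first exact: normc_ge0].
  by rewrite ler_weXn2l// leq_add2r -ltnS prednK// (leq_ltn_trans _ lt_ji).
rewrite Re_sum; under [leRHS]eq_bigr do rewrite Re_sum.
apply: (@le_trans _ _ ((r - 2 * e * n%:R) * \sum_i a i ^+ 2)).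
  apply: ler_pM; rewrite ?divr_ge0 ?(ltW r_gt0)//.
  - by apply: sumr_ge0 => i _; exact: sqr_ge0.
  - rewrite lerBrDr -lerBrDl [leRHS](_ : _ = r / 2); last by field.
    rewrite /e [leLHS](_ : _ = (t * n%:R) / eta); last by field; rewrite gt_eqF.
    rewrite ler_pdivrMr// /eta [leRHS](_ : _ = r / 2 + t * n%:R).
      by rewrite lerDr divr_ge0// ltW.
    by field; rewrite gt_eqF.
  - apply: ler_sum => i _; rewrite /a exprMn ler_peMl ?sqr_ge0//.
    by rewrite -exprM exprn_ege1.
apply: le_trans (ler_sum _ (fun i _ => ler_sum _ (fun j _ => term i j))).
under [leRHS]eq_bigr => i _.
  rewrite sumrB -big_mkcond/= (big_pred1 i) => [|j]; last by rewrite eq_sym.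
  rewrite -mulr_sumr big_split/= sumr_const card_ord.
  over.
rewrite sumrB -mulr_sumr -mulr_sumr big_split/= sumr_const card_ord.
rewrite le_eqVlt; apply/orP; left; apply/eqP; rewrite sumrMnl.
by set Sa := \sum_(i < n) _; rewrite -(mulr_natr Sa); ring.
Qed.

Local Open Scope sesquilinear_scope.

(** A unitary Schur basis makes the matrix triangular with its eigenvalues on the diagonal, where
    [trig_mx_form] provides a real diagonal form. Pulled back to the original basis this is a
    Hermitian matrix [H]. Its real part is symmetric, and since [u] and [A] are real it gives the
    same real part of the form. *)
Lemma lyapunov_mx m (A : 'M[R]_m) :
  (forall l : R[i], eigenvalue (map_mx (real_complex R) A) l ->
     complex.Re l != 0) ->
  exists (S : 'M[R]_m) (c : R), [/\ S^T = S, 0 < c & forall u : 'rV[R]_m,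
    c * \sum_i u 0 i ^+ 2 <= (u *m A *m S *m u^T) 0 0].
Proof.
(* Size 0 is split off because Schur triangularization requires a positive size. *)
case: m A => [|m] A Aeig.
  exists 0, 1; split=> // [|u]; first by apply/matrixP; case.
  by rewrite big_ord0 mulr0 !mxE big_ord0.
set Ac := map_mx _ A in Aeig.
have [P Punit] := @Schur R[i] m.+1 Ac isT.
rewrite /similar_to /= => Ttrig.
set T := conjmx P Ac in Ttrig.
have Tdiag i : complex.Re (T i i) != 0.
  apply: Aeig; apply: (@eigenvalue_conjmx _ _ _ P).
  - by rewrite stablemx_unit// unitarymx_unit.
  - by rewrite row_free_unit unitarymx_unit.
  - rewrite [_ \in _]eigenvalue_root_char char_poly_trig//.
    by rewrite (bigD1 i)//= rootM root_XsubC eqxx.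
have [D [c [c_gt0 Dc]]] := trig_mx_form Ttrig Tdiag.
pose Dm : 'M[R[i]]_m.+1 := diag_mx (\row_j real_complex R (D j)).
pose H := P^t* *m Dm *m P.
exists (map_mx (@complex.Re R) H), c; split=> //.
  apply/matrixP => i j; rewrite !mxE !Re_sum; apply: eq_bigr => k _.
  rewrite !mul_mx_diag !mxE.
  case: (P k j) => x1 y1; case: (P k i) => x2 y2.
  rewrite -![Num.conj _]/(conjc _). simpc => /=. ring.
move=> u; pose uc := map_mx (real_complex R) u.
have [w wE] : exists w : 'rV_m.+1, w = uc *m P^t* by exists (uc *m P^t*).
have w_conj : w^t* = P *m uc^T.
  rewrite wE trmx_mul map_mxM trmxCK; congr (_ *m _).
  apply/matrixP => i j; rewrite !mxE; exact: conjc_real.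
have norm_w : \sum_i normc (w 0 i) ^+ 2 = \sum_i u 0 i ^+ 2.
  apply: (@complexI R); rewrite [LHS]rmorph_sum [RHS]rmorph_sum/=.
  transitivity ((w *m w^t*) 0 0).
    by rewrite mxE; apply: eq_bigr => i _; rewrite -mulc_conj !mxE.
  rewrite w_conj wE mulmxA mulmxKtV// mxE; apply: eq_bigr => i _.
  by rewrite !mxE -rmorphM expr2.
have form_w : \sum_i \sum_j w 0 i * T i j * real_complex R (D j) * conjc (w 0 j)
    = (uc *m Ac *m H *m uc^T) 0 0.
  transitivity ((w *m T *m Dm *m w^t*) 0 0).
    rewrite [RHS]mxE exchange_big; apply: eq_bigr => j _ /=.
    rewrite mul_mx_diag mxE mxE !mulr_suml.
    by apply: eq_bigr => i _; rewrite !mxE.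
  by rewrite w_conj wE /T conjymx// /H !mulmxA mulmxKtV.
have := Dc (w 0); rewrite norm_w form_w; congr (_ <= _).
rewrite -map_mxM mxE [RHS]mxE Re_sum; apply: eq_bigr => j _.
rewrite mxE [in RHS]mxE !mulr_suml Re_sum; apply: eq_bigr => i _.
by rewrite !mxE; case: (\sum_j0 (_ *m _) _ _ * _) => a b /=; ring.
Qed.
End complex_facts.

(** * Euclidean geometry and short arcs of curves *)

Section euclidean.
Variables (R : realType) (d : nat).
Implicit Types (u v w : 'rV[R]_d) (a b c s k : R).

Definition edot u v : R := \sum_i u 0 i * v 0 i.

Local Notation N := (@eucl_norm R d).

Lemma edotE u v : edot u v = (u *m v^T) 0 0.
Proof. by rewrite mxE; apply: eq_bigr => i _; rewrite !mxE. Qed.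

Lemma edotC u v : edot u v = edot v u.
Proof. by apply: eq_bigr => i _; rewrite mulrC. Qed.

Lemma edotDl u v w : edot (u + v) w = edot u w + edot v w.
Proof. by rewrite /edot -big_split; apply: eq_bigr => i _; rewrite mxE mulrDl. Qed.

Lemma edotZl a u v : edot (a *: u) v = a * edot u v.
Proof. by rewrite /edot mulr_sumr; apply: eq_bigr => i _; rewrite mxE mulrA. Qed.

Lemma edotNl u v : edot (- u) v = - edot u v.
Proof. by rewrite -scaleN1r edotZl mulN1r. Qed.

Lemma edotBl u v w : edot (u - v) w = edot u w - edot v w.
Proof. by rewrite edotDl edotNl. Qed.

Lemma edotDr u v w : edot u (v + w) = edot u v + edot u w.
Proof. by rewrite edotC edotDl !(edotC u). Qed.

Lemma edotZr a u v : edot u (a *: v) = a * edot u v.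
Proof. by rewrite edotC edotZl edotC. Qed.

Lemma edotBr u v w : edot u (v - w) = edot u v - edot u w.
Proof. by rewrite edotC edotBl !(edotC u). Qed.

Lemma enorm_ge0 v : 0 <= N v. Proof. exact: sqrtr_ge0. Qed.

Lemma sqr_enorm v : N v ^+ 2 = edot v v.
Proof. by rewrite sqr_sqrtr// sumr_ge0// => i _; exact: sqr_ge0. Qed.

Lemma enorm0 : N 0 = 0.
Proof. by rewrite /eucl_norm big1 ?sqrtr0// => i _; rewrite mxE expr0n. Qed.

Lemma enormZ a v : N (a *: v) = `|a| * N v.
Proof.
rewrite /eucl_norm -sqrtr_sqr -sqrtrM ?sqr_ge0// mulr_sumr; congr Num.sqrt.
by apply: eq_bigr => i _; rewrite mxE exprMn.
Qed.

Lemma enormN v : N (- v) = N v.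
Proof. by rewrite -scaleN1r enormZ normrN1 mul1r. Qed.

Lemma enormBC u v : N (u - v) = N (v - u).
Proof. by rewrite -enormN opprB. Qed.

Lemma normr_le_enorm v : `|v| <= N v.
Proof.
rewrite [leLHS]/Num.Def.normr/= mx_normrE; apply: bigmax_le; rewrite ?enorm_ge0//.
move=> [i j] _ /=; rewrite (ord1 i) -sqrtr_sqr ler_wsqrtr//.
by rewrite (bigD1 j)//= lerDl sumr_ge0// => k _; exact: sqr_ge0.
Qed.

Lemma normr_coord_le v (i : 'I_d) : `|v 0 i| <= `|v|.
Proof.
rewrite [leRHS]/Num.Def.normr/= mx_normrE.
exact: (le_bigmax _ (fun p : _ * _ => `|v p.1 p.2|) (0, i)).
Qed.

Lemma enorm_eq0 v : N v = 0 -> v = 0.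
Proof. by move=> v0; apply/eqP; rewrite -normr_le0 -v0 normr_le_enorm. Qed.

Lemma cauchy_schwarz u v : `|edot u v| <= N u * N v.
Proof.
suff CS x y : edot x y <= N x * N y.
  by rewrite ler_norml CS andbT lerNl -edotNl -(enormN u) CS.
have [/enorm_eq0->|xn0] := eqVneq (N x) 0.
  by rewrite -(scale0r 0) edotZl mul0r mulr_ge0 ?enorm_ge0.
have [/enorm_eq0->|yn0] := eqVneq (N y) 0.
  by rewrite -(scale0r 0) edotZr mul0r mulr_ge0 ?enorm_ge0.
have xy_gt0 : 0 < N x * N y by rewrite mulr_gt0// lt0r ?xn0 ?yn0 enorm_ge0.
have := sqr_ge0 (N (N y *: x - N x *: y)).
rewrite sqr_enorm edotBl !edotBr !edotZl !edotZr -!sqr_enorm (edotC y x) => h.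
rewrite -(ler_pM2l xy_gt0); lra.
Qed.

Lemma enormD u v : N (u + v) <= N u + N v.
Proof.
rewrite -(@ler_pXn2r _ 2) ?nnegrE ?addr_ge0 ?enorm_ge0//.
rewrite sqr_enorm edotDl !edotDr -!sqr_enorm (edotC v u).
have := le_trans (ler_norm _) (cauchy_schwarz u v); nra.
Qed.

Lemma enormB u v : N (u - v) <= N u + N v.
Proof. by rewrite -(enormN v) enormD. Qed.

Lemma lerB_enormD u v : N u - N v <= N (u + v).
Proof. by rewrite lerBlDr -{1}(addrK v u) enormB. Qed.

Lemma enorm_le_normr v : N v <= d%:R * `|v|.
Proof.
rewrite -(@ler_pXn2r _ 2) ?nnegrE ?mulr_ge0 ?enorm_ge0//.
rewrite sqr_enorm exprMn.
apply: (@le_trans _ _ (\sum_(i < d) `|v| ^+ 2)).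
  apply: ler_sum => i _; rewrite -expr2 -(real_normK (num_real (v 0 i))).
  by rewrite ler_pXn2r ?nnegrE// normr_coord_le.
rewrite sumr_const card_ord -[leLHS]mulr_natl ler_wpM2r ?sqr_ge0//.
by rewrite -natrX ler_nat; case: (d) => // n; rewrite -mulnn leq_pmulr.
Qed.

(** The main term [k * s * N v ^+ 2] loses at most the fractions 1/3, 1/3 and 1/9 to the two cross
    terms and the product of the errors. *)
Lemma edot_near_ge0 v (p q : 'rV[R]_d) s k : 0 <= s -> 0 <= k ->
  N (p - k *: v) <= 3^-1 * N v * k -> N (q - s *: v) <= 3^-1 * N v * s ->
  0 <= edot p q.
Proof.
move=> s_ge0 k_ge0.
have [e1 ->] : exists e1, p = e1 + k *: v by exists (p - k *: v); rewrite subrK.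
have [e2 ->] : exists e2, q = e2 + s *: v by exists (q - s *: v); rewrite subrK.
rewrite !addrK => hp hq; rewrite edotDl !edotDr !edotZl !edotZr -sqr_enorm.
have := cauchy_schwarz e1 e2; have := cauchy_schwarz e1 v.
have := cauchy_schwarz v e2.
rewrite !ler_norml => /andP[h1 _] /andP[h2 _] /andP[h3 _].
have h4 : N e1 * N e2 <= (3^-1 * N v * k) * (3^-1 * N v * s).
  by apply: ler_pM; rewrite ?enorm_ge0.
have h5 : k * - (N v * (3^-1 * N v * s)) <= k * edot v e2.
  by rewrite ler_wpM2l//; apply: le_trans h1; rewrite lerN2 ler_wpM2l ?enorm_ge0.
have h6 : s * - ((3^-1 * N v * k) * N v) <= s * edot e1 v.
  by rewrite ler_wpM2l//; apply: le_trans h2; rewrite lerN2 ler_wpM2r ?enorm_ge0.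
have h7 : 0 <= k * s * N v ^+ 2 by rewrite mulr_ge0 ?sqr_ge0 ?mulr_ge0.
lra.
Qed.

Lemma enorm_leD_ge0 (p q : 'rV[R]_d) : 0 <= edot p q -> N q <= N (p + q).
Proof.
move=> pq; rewrite -(@ler_pXn2r _ 2) ?nnegrE ?enorm_ge0// [leRHS]sqr_enorm.
rewrite edotDl !edotDr -!sqr_enorm (edotC q p).
have := sqr_ge0 (N p); lra.
Qed.

End euclidean.

Section curves.
Variables (R : realType) (d : nat).
Implicit Types (u v w : 'rV[R]_d) (g : R -> 'rV[R]_d) (a b c : R).
Local Notation N := (@eucl_norm R d).

Lemma is_derive_coord g (s : R) v (i : 'I_d) :
  is_derive s 1 g v ->
  is_derive s 1 (fun t : R => g t 0 i : R) (v 0 i).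
Proof.
case=> dg vE; have dgi := (derivable_mxP g s 1).1 dg 0 i.
by split=> //; rewrite -vE derive_mx// mxE.
Qed.

Lemma is_derive_edot g (s : R) v w :
  is_derive s 1 g v ->
  is_derive s 1 (fun t : R => edot (g t) w : R) (edot v w).
Proof.
move=> gv; rewrite /edot.
have -> : (fun t : R => \sum_i g t 0 i * w 0 i) =
    \sum_i (fun t : R => g t 0 i * w 0 i : R).
  by apply/funext => t; rewrite fct_sumE.
apply: is_derive_sum => i; have gi := is_derive_coord i gv.
have wi := is_derive_cst (w 0 i : R) s 1.
apply: is_derive_eq (is_deriveM gi wi) _.
by rewrite scaler0 add0r [LHS]mulrC.
Qed.

Lemma MVT_closed (f df : R -> R) a b : a <= b ->
  (forall s, s \in `[a, b]%R -> is_derive s 1 f (df s)) ->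
  exists2 c, c \in `[a, b]%R & f b - f a = df c * (b - a).
Proof.
move=> ab fdf; have H := @MVT_segment R f df a b ab; apply H => [x xab|].
  by apply: fdf; exact: subset_itv_oo_cc xab.
by apply: derivable_within_continuous => x xab; case: (fdf x xab).
Qed.

(** A vector-valued mean value inequality without integrals: the scalar mean value theorem is
    applied to the inner product of [g] with the error vector [e] itself, and one factor [N e] is
    cancelled. *)
Lemma curve_mean_value g (g' : R -> 'rV[R]_d) v (K : R) a b : a <= b ->
  (forall s, s \in `[a, b]%R ->
    is_derive s 1 g (g' s)) ->
  (forall s, s \in `[a, b]%R -> N (g' s - v) <= K) ->
  N (g b - g a - (b - a) *: v) <= K * (b - a).
Proof.
move=> ab gg' g'v; set e := (X in N X).
have ba : 0 <= b - a by rewrite subr_ge0.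
have [->|en0] := eqVneq (N e) 0.
  have K_ge0 : 0 <= K.
    by apply: le_trans (g'v a _); rewrite ?enorm_ge0// in_itv/= lexx.
  exact: mulr_ge0.
have e_gt0 : 0 < N e by rewrite lt0r en0 enorm_ge0.
have [c cab cE] := MVT_closed ab (fun s sab => is_derive_edot e (gg' s sab)).
rewrite -(ler_pM2r e_gt0) -expr2 sqr_enorm {1}/e edotBl edotBl cE edotZl.
rewrite mulrC -mulrBr -edotBl [leRHS]mulrAC [leRHS]mulrC ler_wpM2l//.
apply: le_trans (ler_norm _) _; apply: le_trans (cauchy_schwarz _ _) _.
by rewrite ler_wpM2r ?enorm_ge0// g'v.
Qed.

Lemma enorm_continuous (x : 'rV[R]_d) : {for x, continuous (N : 'rV[R]_d -> R)}.
Proof.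
apply/(@cvgrPdist_le _ _ _ (nbhs x)) => e e0.
(* Comparing the two norms costs a factor [d]; [d.+1] keeps the divisor nonzero when [d = 0]. *)
have de_gt0 : 0 < e / d.+1%:R by rewrite divr_gt0.
apply: filterS (nbhsx_ballx x _ de_gt0) => y; rewrite mx_norm_ball /ball_/= => xy.
have NN u v : N u - N v <= N (u - v) by rewrite lerBlDr -{1}(subrK v u) enormD.
apply: (@le_trans _ _ (N (x - y))).
  by rewrite ler_norml NN andbT lerNl opprB enormBC NN.
apply: le_trans (enorm_le_normr _) _.
apply: (@le_trans _ _ (d.+1%:R * `|x - y|)).
  by rewrite ler_wpM2r// ler_nat.
by rewrite mulrC -ler_pdivlMr// ltW.
Qed.

Section short_arc.
Variables (g g' : R -> 'rV[R]_d) (tau L : R).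
Hypotheses (tau_ge0 : 0 <= tau) (L_ge0 : 0 <= L) (Ltau : L * tau <= 4^-1).
Hypothesis gg' : forall s, s \in `[0, tau]%R ->
  is_derive s 1 g (g' s).
Hypothesis g'L : forall s, s \in `[0, tau]%R ->
  N (g' s - g' 0) <= L * N (g s - g 0).

(** If [D] is the largest distance to [g 0], reached at time [c], the mean value inequality gives
    [D <= tau * N (g' 0) + D / 4], and the last term is absorbed on the left. *)
Lemma short_arc_bound s : s \in `[0, tau]%R ->
  N (g s - g 0) <= 4 / 3 * tau * N (g' 0).
Proof.
have cg : {within `[0, tau], continuous (fun s : R => N (g s - g 0))}.
  have : {within `[0, tau], continuous g}.
    by apply: derivable_within_continuous => x /gg'[].
  move=> cg x.
  apply: (@continuous_comp _ _ _ (fun s : subspace `[0, tau] => g s - g 0)).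
    by apply: continuousB; [exact: cg|exact: cst_continuous].
  exact: enorm_continuous.
have [c c_in gc] := EVT_max tau_ge0 cg.
move=> s_in; apply: le_trans (gc _ s_in) _.
move: (c_in); rewrite in_itv/= => /andP[c_ge0 c_tau].
have sub r : r \in `[0, c]%R -> r \in `[0, tau]%R.
  by rewrite !in_itv/= => /andP[-> /le_trans]; exact.
have := @curve_mean_value g g' (g' 0) (L * N (g c - g 0)) 0 c c_ge0
  (fun r rc => gg' (sub r rc)) _.
rewrite subr0 => /(_ _)/le_trans H.
have {}H : N (g c - g 0 - c *: g' 0) <= L * N (g c - g 0) * c.
  apply: H => // r rc; apply: le_trans (g'L (sub r rc)) _.
  by rewrite ler_wpM2l// gc// sub.
have := enormD (g c - g 0 - c *: g' 0) (c *: g' 0).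
rewrite subrK enormZ ger0_norm// => H2.
have : L * N (g c - g 0) * c <= 4^-1 * N (g c - g 0).
  rewrite mulrAC ler_wpM2r ?enorm_ge0//; apply: le_trans Ltau.
  by rewrite ler_wpM2l.
have : c * N (g' 0) <= tau * N (g' 0) by rewrite ler_wpM2r ?enorm_ge0.
lra.
Qed.

(** By [short_arc_bound] the velocity stays within a third of [N v] from [v = g' 0]. The increments
    over [[0, s]] and [[s, tau]] are then both close to nonnegative multiples of [v], so their inner
    product is nonnegative and adding the second cannot shorten the first. *)
Lemma short_arc_monotone s : s \in `[0, tau]%R ->
  N (g s - g 0) <= N (g tau - g 0).
Proof.
move=> s_in; set v := g' 0.
have g'v r : r \in `[0, tau]%R -> N (g' r - v) <= 3^-1 * N v.
  move=> r_in; apply: le_trans (g'L r_in) _.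
  apply: (@le_trans _ _ (L * (4 / 3 * tau * N v))).
    by rewrite ler_wpM2l// short_arc_bound.
  rewrite [leLHS](_ : _ = 4 / 3 * N v * (L * tau)); last by ring.
  apply: (@le_trans _ _ (4 / 3 * N v * 4^-1)); last by lra.
  by rewrite ler_wpM2l// mulr_ge0 ?enorm_ge0.
have /andP[s_ge0 s_tau] : 0 <= s <= tau by move: s_in; rewrite in_itv.
have sub1 r : r \in `[0, s]%R -> r \in `[0, tau]%R.
  by rewrite !in_itv/= => /andP[-> /le_trans]; exact.
have sub2 r : r \in `[s, tau]%R -> r \in `[0, tau]%R.
  by rewrite !in_itv/= => /andP[/(le_trans s_ge0)-> ->].
have := curve_mean_value s_ge0 (fun r rc => gg' (sub1 r rc))
  (fun r rc => g'v r (sub1 r rc)).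
have := curve_mean_value s_tau (fun r rc => gg' (sub2 r rc))
  (fun r rc => g'v r (sub2 r rc)).
rewrite subr0.
rewrite -[X in N (g s - g 0) <= N X](subrKA (g s)) => hp hq.
by apply: enorm_leD_ge0; apply: edot_near_ge0 hp hq; rewrite ?subr_ge0.
Qed.

End short_arc.
End curves.

(** * Differentiability and Lipschitz estimates *)

Section directional.
Variables (R : realType) (W V : normedModType R).

(** The two difference quotients coincide. This serves for segments and curves in space, and with
    [W] the real line for affine changes of time. *)
Lemma is_derive_line (F : W -> V) (x v : W) (w : V) (t : R) :
  is_derive (t *: v + x) v F w -> is_derive t 1 (fun s : R => F (s *: v + x)) w.
Proof.
case=> dF vE.
have E : (fun h : R => h^-1 *: (((fun s : R => F (s *: v + x)) \o shift t) (h *: 1)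
      - F (t *: v + x))) =
    (fun h => h^-1 *: ((F \o shift (t *: v + x)) (h *: v) - F (t *: v + x))).
  by apply/funext => h /=; rewrite /shift/= addrA -scalerDl [_ *: 1]mulr1.
by split; rewrite /derivable /derive E.
Qed.

Lemma is_derive1_dir (F : R -> V) (a c : R) (w : V) :
  is_derive a 1 F w -> is_derive a c F (c *: w).
Proof.
case=> dF <-; have dF' := (derivable1_diffP F a).1 dF.
split; first exact: diff_derivable.
by rewrite !deriveE// diff1E// scale1r.
Qed.

End directional.

Section lipschitz.
Variables (R : realType) (d : nat).
Local Notation N := (@eucl_norm R d).

Lemma nbhs_eball (p : 'rV[R]_d) (P : set 'rV[R]_d) : nbhs p P ->
  exists2 r : R, 0 < r & forall y, N (y - p) < r -> P y.
Proof.
move=> /nbhs_ballP[r /= r0 rP]; exists r => // y ypr; apply: rP.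
rewrite mx_norm_ball /ball_/= distrC.
exact: le_lt_trans (normr_le_enorm _) ypr.
Qed.

Lemma eball_nbhs (p : 'rV[R]_d) (r : R) : 0 < r -> nbhs p [set y | N (y - p) < r].
Proof.
move=> r_gt0.
have d_gt0 : 0 < r / d.+1%:R by rewrite divr_gt0.
apply: filterS (nbhsx_ballx p _ d_gt0) => y; rewrite mx_norm_ball /ball_/= => py.
apply: le_lt_trans (enorm_le_normr _) _.
apply: (@le_lt_trans _ _ (d.+1%:R * `|y - p|)).
  by rewrite ler_wpM2r// ler_nat.
by rewrite mulrC -ltr_pdivlMr// distrC.
Qed.

Lemma enorm_sum (I : finType) (f : I -> 'rV[R]_d) :
  N (\sum_i f i) <= \sum_i N (f i).
Proof.
apply: (big_ind2 (fun u a => N u <= a)) => //; first by rewrite enorm0.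
by move=> u a v b ua vb; exact: le_trans (enormD _ _) (lerD ua vb).
Qed.

Lemma linear_enorm_le m (f : {linear 'rV[R]_m -> 'rV[R]_d}) (v : 'rV[R]_m) :
  N (f v) <= (\sum_j N (f (delta_mx 0 j))) * eucl_norm v.
Proof.
rewrite {1}[v]row_sum_delta linear_sum mulr_suml.
apply: le_trans (enorm_sum _) _; apply: ler_sum => j _.
rewrite linearZZ enormZ mulrC ler_wpM2l ?enorm_ge0//.
exact: le_trans (normr_coord_le _ _) (normr_le_enorm _).
Qed.

(** Near [p] each partial derivative exceeds its norm at [p] by at most 1, by continuity. Balls are
    convex, so the mean value inequality with [v = 0] applies along segments. *)
Lemma C1_lipschitz (U : set 'rV[R]_d) (F : 'rV[R]_d -> 'rV[R]_d) (p : 'rV[R]_d) :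
  open U -> U p -> Cn_on 1 U F ->
  exists (r L : R), [/\ 0 < r, 0 <= L,
    (forall x, N (x - p) < r -> U x) &
    forall x y, N (x - p) < r -> N (y - p) < r -> N (F y - F x) <= L * N (y - x)].
Proof.
move=> oU Up [dF cF].
have near_bound (j : 'I_d) : \forall y \near p,
    N ('d F y (delta_mx 0 j)) <= N ('d F p (delta_mx 0 j)) + 1.
  have : ((fun y => N ('d F y (delta_mx 0 j))) @ p) --> N ('d F p (delta_mx 0 j)).
    apply: (@continuous_comp _ _ _ (fun y => 'd F y (delta_mx 0 j)) N).
      exact: cF.
    exact: enorm_continuous.
  move=> /(@cvgrPdist_le _ _ _ (nbhs p))/(_ 1 ltr01); apply: filterS => y.
  by rewrite ler_norml => /andP[+ _]; rewrite lerNl opprB lerBlDl.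
have : \forall y \near p, U y /\
    forall j, N ('d F y (delta_mx 0 j)) <= N ('d F p (delta_mx 0 j)) + 1.
  apply: filterI; first exact: open_nbhs_nbhs.
  by have := @filter_forall _ _ _ (nbhs p) _ near_bound; apply.
move=> /nbhs_eball[r r_gt0 rP].
exists r, (\sum_j (N ('d F p (delta_mx 0 j)) + 1)); split=> //.
- by apply: sumr_ge0 => j _; rewrite addr_ge0// enorm_ge0.
- by move=> x /rP[].
move=> x y xr yr; set L := \sum_j _.
have in_ball (t : R) : t \in `[0, 1]%R -> N (t *: (y - x) + x - p) < r.
  rewrite in_itv/= => /andP[t0 t1].
  have -> : t *: (y - x) + x - p = t *: (y - p) + (1 - t) *: (x - p).
    by apply/rowP => i; rewrite !mxE; ring.
  apply: le_lt_trans (enormD _ _) _; rewrite !enormZ !ger0_norm ?subr_ge0//.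
  have [->|tn0] := eqVneq t 0; first by rewrite mul0r add0r subr0 mul1r.
  have t_gt0 : 0 < t by rewrite lt0r tn0.
  have : t * N (y - p) < t * r by rewrite ltr_pM2l.
  have : (1 - t) * N (x - p) <= (1 - t) * r.
    by rewrite ler_wpM2l ?subr_ge0// ltW.
  lra.
have derF (t : R) : t \in `[0, 1]%R ->
    is_derive t 1 (fun s : R => F (s *: (y - x) + x)) ('d F (t *: (y - x) + x) (y - x)).
  move=> /in_ball/rP[Ut _]; apply: is_derive_line.
  have dFt := dF _ Ut; split; first exact: diff_derivable.
  by rewrite deriveE.
have := curve_mean_value (K := L * N (y - x)) ler01 derF.
move=> /(_ 0); rewrite scale1r subrK scale0r add0r scaler0 !subr0 mulr1; apply.
move=> t /in_ball/rP[_ bnd]; rewrite subr0.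
apply: le_trans (linear_enorm_le _ _) _.
by rewrite ler_wpM2r ?enorm_ge0//; apply: ler_sum => j _.
Qed.

End lipschitz.

(** * The vector field near a hyperbolic fixed point *)

Section tangent.
Variables (R : realType) (d : nat).
Local Notation N := (@eucl_norm R d).

Lemma diff_enorm_approx (f : 'rV[R]_d -> 'rV[R]_d) (a : 'rV[R]_d) (e : R) :
  differentiable f a -> 0 < e ->
  exists2 r : R, 0 < r & forall y, N (y - a) < r ->
    N (f y - f a - 'd f a (y - a)) <= e * N (y - a).
Proof.
move=> df e_gt0.
have e'_gt0 : 0 < e / d.+1%:R by rewrite divr_gt0.
have /eqaddoP/(_ _ e'_gt0)/nbhs_eball[r r_gt0 rP] := diff_locally df.
exists r => // y yr.
have := rP (y - a); rewrite subr0 => /(_ yr).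
rewrite /= !fctE /= subrK opprD addrA => H.
apply: le_trans (enorm_le_normr _) _.
apply: (@le_trans _ _ (d.+1%:R * (e / d.+1%:R * `|y - a|))).
  by apply: ler_pM => //; rewrite ler_nat.
rewrite mulrA mulrCA divff ?mulr1 ?pnatr_eq0//.
by rewrite ler_wpM2l ?normr_le_enorm// ltW.
Qed.

Lemma diff_enorm_lip (f : 'rV[R]_d -> 'rV[R]_d) (a : 'rV[R]_d) :
  differentiable f a ->
  exists (r L : R), [/\ 0 < r, 0 < L & forall y, N (y - a) < r ->
    N (f y - f a) <= L * N (y - a)].
Proof.
move=> df; have [r r_gt0 rP] := diff_enorm_approx df ltr01.
exists r, (1 + \sum_j N ('d f a (delta_mx 0 j))); split=> //.
  by rewrite ltr_pwDl// sumr_ge0// => j _; exact: enorm_ge0.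
move=> y /rP H; rewrite -(subrK ('d f a (y - a)) (f y - f a)).
apply: le_trans (enormD _ _) _; rewrite mulrDl lerD//.
exact: linear_enorm_le.
Qed.

(** In a chart [M] is flat: the line from [Phi p] to [Phi y] is carried by [Psi] to a curve in [M],
    whose velocity [v] at [p] approximates [y - p] to first order. The precision [e / L] asked of
    [Psi] compensates for the Lipschitz constant [L] of [Phi] at [p]. *)
Lemma tangent_approx (k : nat) (M : set 'rV[R]_d) (p : 'rV[R]_d) (e : R) :
  C2_manifold k M -> M p -> 0 < e ->
  exists2 r : R, 0 < r & forall y, M y -> N (y - p) < r ->
    exists2 v, tangent_space M p v & N (y - p - v) <= e * N (y - p).
Proof.
move=> [_ chart] Mp e_gt0.
have [U [V [Phi [Psi [[oU oV] Up [CPhi CPsi] [UV VU] slice]]]]] := chart p Mp.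
set b := Phi p; have [Vb Psib] := UV p Up.
have [r1 [L [r1_gt0 L_gt0 PhiL]]] := diff_enorm_lip (CPhi.1 _ Up).
have [r2 r2_gt0 PsiA] := diff_enorm_approx (CPsi.1 _ Vb) (divr_gt0 e_gt0 L_gt0).
have [r3 r3_gt0 r3U] := nbhs_eball (open_nbhs_nbhs (conj oU Up)).
exists (Num.min r1 (Num.min (r2 / L) r3)).
  by rewrite !lt_min r1_gt0 r3_gt0 divr_gt0.
move=> y My; rewrite !lt_min ltr_pdivlMr// => /and3P[yr1 yr2 /r3U Uy].
have [Vy Psiy] := UV y Uy; set z := Phi y.
have zb : N (z - b) <= L * N (y - p) by exact: PhiL.
exists ('d Psi b (z - b)); last first.
  rewrite -{1}Psiy -{1}Psib; apply: le_trans (PsiA _ _) _.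
    by apply: le_lt_trans zb _; rewrite mulrC.
  rewrite -mulrA ler_wpM2l ?(ltW e_gt0)//.
  by rewrite mulrC ler_pdivrMr// mulrC.
(* [tangent_space] asks for curves defined on all of [R]: outside the chart the
   curve is set to [p]. *)
pose line (t : R) := t *: (z - b) + b.
pose gamma (t : R) := if pselect (V (line t)) then Psi (line t) else p.
exists gamma; split.
- move=> t; rewrite /gamma; case: pselect => // Vt.
  have [Ut PhiPsi] := VU _ Vt.
  apply/(slice _ Ut) => i ki; rewrite PhiPsi !mxE.
  rewrite ((slice _ Uy).1 My i ki) ((slice _ Up).1 Mp i ki).
  by rewrite subrr mulr0 addr0.
- rewrite /gamma /line scale0r add0r.
  by case: pselect => // _; rewrite Psib.
- have dPsi : is_derive (0 *: (z - b) + b) (z - b) Psi ('d Psi b (z - b)).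
    rewrite scale0r add0r; have dPsib := CPsi.1 _ Vb.
    by split; [exact: diff_derivable|rewrite deriveE].
  have dline := is_derive_line dPsi.
  have cline : {for (0 : R), continuous line}.
    apply: continuousD; last exact: cst_continuous.
    exact: scalel_continuous.
  have Vline : \forall t \near (0 : R), V (line t).
    by apply: cline; rewrite /line scale0r add0r; exact: open_nbhs_nbhs.
  have gammaE : \forall t \near (0 : R), Psi (line t) = gamma t.
    by apply: filterS Vline => t Vt; rewrite /gamma; case: pselect.
  exact: (near_eq_is_derive gammaE dline).
Qed.

Lemma mulmx_enorm_le m n (Q : 'M[R]_(m, n)) : exists2 K : R, 0 < K &
  forall u : 'rV[R]_m, eucl_norm (u *m Q) <= K * eucl_norm u.
Proof.
exists (1 + \sum_j eucl_norm (delta_mx 0 j *m Q : 'rV_n)).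
  by rewrite ltr_pwDl// sumr_ge0// => j _; exact: enorm_ge0.
move=> u; have := linear_enorm_le (mulmxr Q : {linear 'rV[R]_m -> 'rV[R]_n}) u.
by move/le_trans; apply; rewrite mulrDl lerDr mul1r enorm_ge0.
Qed.

Lemma edot_mulmx m n (Q : 'M[R]_(m, n)) (u : 'rV[R]_m) (v : 'rV[R]_n) :
  edot (u *m Q) v = edot u (v *m Q^T).
Proof.
by rewrite !edotE trmx_mul trmxK mulmxA.
Qed.

(** For [y] in [M] near [p], [y - p] is almost tangent and [X y] is almost [DX(p)] applied to it, so
    the bound of [lyapunov_mx] on the tangent space survives with a smaller constant. *)
Lemma hyperbolic_form (k : nat) (M : set 'rV[R]_d) (X : 'rV[R]_d -> 'rV[R]_d)
    (p : 'rV[R]_d) :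
  C2_manifold k M -> M p -> X p = 0 -> hyperbolic M X p ->
  exists (Q : 'M[R]_d) (c r : R), [/\ Q^T = Q, 0 < c, 0 < r &
    forall y, M y -> N (y - p) < r ->
      c * N (y - p) ^+ 2 <= edot (X y *m Q) (y - p)].
Proof.
move=> Mm Mp Xp0 [m [B [A [[Bfree TB [F [[U [oU Up CF FX]] FA]]] Aeig]]]].
have [S [c0 [Ssym c0_gt0 SA]]] := lyapunov_mx Aeig.
have [C BC] : exists C : 'M[R]_(d, m), B *m C = 1%:M.
  by exists (pinvmx B); exact: mulmxVp.
(* As [B *m C] is the identity, this extends the form [S] from coordinates in the basis [B] to all
   of R^d. *)
pose Q := C *m S *m C^T.
have Qsym : Q^T = Q by rewrite /Q !trmx_mul trmxK Ssym mulmxA.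
have [KB KB_gt0 KBle] := mulmx_enorm_le B.
have [KQ KQ_gt0 KQle] := mulmx_enorm_le Q.
have dF := CF.1 _ Up.
pose D : {linear 'rV[R]_d -> 'rV[R]_d} := 'd F p.
pose KD : R := \sum_j N (D (delta_mx 0 j)).
have KD_ge0 : 0 <= KD by apply: sumr_ge0 => j _; exact: enorm_ge0.
have KDle v : N (D v) <= KD * N v by exact: linear_enorm_le.
pose c1 := c0 / KB ^+ 2.
have c1_gt0 : 0 < c1 by rewrite divr_gt0// exprn_gt0.
have formT v : tangent_space M p v -> c1 * N v ^+ 2 <= edot (D v *m Q) v.
  rewrite TB /= => /submxP[u ->]; rewrite [D _]FA.
  apply: (@le_trans _ _ (c0 * eucl_norm u ^+ 2)).
    rewrite /c1 -mulrA ler_wpM2l ?(ltW c0_gt0)// mulrC ler_pdivrMr ?exprn_gt0//.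
    rewrite -exprMn ler_pXn2r ?nnegrE ?mulr_ge0 ?enorm_ge0 ?(ltW KB_gt0)//.
    by rewrite mulrC.
  have := SA u; rewrite sqr_enorm; congr (_ * _ <= _).
  rewrite edotE trmx_mul /Q; congr (fun_of_matrix _ 0 0).
  rewrite -!mulmxA; congr (_ *m (_ *m _)).
  by rewrite mulmxA BC mul1mx (mulmxA C^T) -trmx_mul BC trmx1 mul1mx.
(* Error budget: since [e <= 1/2], the tangent part contributes at least [c1 / 4] times [n ^+ 2].
   The errors add up to [e * (3 * KQ * KD + KQ)] times [n ^+ 2], and [K] is chosen to keep this
   below [c1 / 8]. *)
pose K : R := 8 * (3 * KQ * KD + KQ) / c1.
have K_ge0 : 0 <= K.
  by rewrite divr_ge0 ?(ltW c1_gt0)// mulr_ge0// addr_ge0 ?mulr_ge0 ?(ltW KQ_gt0).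
pose e : R := (2 + K)^-1.
have e_gt0 : 0 < e by rewrite invr_gt0 ltr_wpDr.
have e_le : e <= 2^-1 by rewrite lef_pV2 ?posrE ?ltr_wpDr// lerDl.
have e_le' : e * (3 * KQ * KD + KQ) <= c1 / 8.
  rewrite /e mulrC ler_pdivrMr ?ltr_wpDr//.
  rewrite (_ : 3 * KQ * KD + KQ = c1 / 8 * K); last first.
    by rewrite /K; field; rewrite gt_eqF.
  by rewrite ler_wpM2l ?lerDr// divr_ge0 ?(ltW c1_gt0).
have [r1 r1_gt0 Tapp] := tangent_approx Mm Mp e_gt0.
have [r2 r2_gt0 Fapp] := diff_enorm_approx dF e_gt0.
have [r3 r3_gt0 r3U] := nbhs_eball (open_nbhs_nbhs (conj oU Up)).
exists Q, (c1 / 8), (Num.min r1 (Num.min r2 r3)); split=> //.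
- by rewrite divr_gt0.
- by rewrite !lt_min r1_gt0 r2_gt0.
move=> y My; rewrite !lt_min => /and3P[yr1 /Fapp + /r3U Uy].
have [v Tv] := Tapp y My yr1.
rewrite (FX _ Up Mp) (FX _ Uy My) Xp0 subr0.
set w := y - p; set n := N w => vapp Xapp.
have [f fE] : exists f, f = w - v by exists (w - v).
have [g gE] : exists g, g = X y - D w by exists (X y - D w).
have XE : X y = D v + (D f + g).
  rewrite gE fE linearB; move: (D v) (D w) => Dv Dw.
  by apply/rowP => i; rewrite !mxE; ring.
have wE : w = v + f by rewrite fE addrC subrK.
have vE : v = w - f by rewrite fE subKr.
rewrite -fE in vapp; rewrite -gE in Xapp.
have n_ge0 : 0 <= n by exact: enorm_ge0.
have nv : n - e * n <= N v.
  have := lerB_enormD w (- f); rewrite -vE enormN -/n; lra.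
have nv2 : N v <= 2 * n.
  have := enormB w f; rewrite -vE -/n.
  have : e * n <= 2^-1 * n by rewrite ler_wpM2r.
  lra.
have h1 : c1 * (n / 2) ^+ 2 <= edot (D v *m Q) v.
  apply: le_trans (formT v Tv); rewrite ler_wpM2l ?(ltW c1_gt0)//.
  rewrite ler_pXn2r ?nnegrE ?divr_ge0 ?enorm_ge0//.
  have : e * n <= 2^-1 * n by rewrite ler_wpM2r.
  lra.
have CS (a b : 'rV[R]_d) (na nb : R) : N a <= na -> N b <= nb ->
    - (KQ * na * nb) <= edot (a *m Q) b.
  move=> ana bnb; have := cauchy_schwarz (a *m Q) b.
  rewrite ler_norml => /andP[+ _]; apply: le_trans; rewrite lerN2.
  apply: ler_pM; rewrite ?enorm_ge0//; apply: le_trans (KQle _) _.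
  by rewrite ler_wpM2l ?(ltW KQ_gt0).
have h2 : - (KQ * (KD * (2 * n)) * (e * n)) <= edot (D v *m Q) f.
  apply: CS => //; apply: le_trans (KDle _) _.
  by rewrite ler_wpM2l.
have h3 : - (KQ * (KD * (e * n) + e * n) * n) <= edot ((D f + g) *m Q) w.
  apply: CS => //; apply: le_trans (enormD _ _) _; rewrite lerD//.
  by apply: le_trans (KDle _) _; rewrite ler_wpM2l.
(* The form splits into the tangent part [h1] and the two error terms bounded by [h2] and [h3]. *)
rewrite XE mulmxDl edotDl {1}wE edotDr.
have : e * (3 * KQ * KD + KQ) * n ^+ 2 <= c1 / 8 * n ^+ 2.
  by rewrite ler_wpM2r ?sqr_ge0.
have : 0 <= c1 * n ^+ 2 by rewrite mulr_ge0 ?sqr_ge0 ?(ltW c1_gt0).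
rewrite !expr2 in h1 *; lra.
Qed.

End tangent.

(** * Return times of orbits *)

(** The form is expanded into a sum of products of scalar functions, to which the scalar product
    rule applies; the symmetry of [Q] merges the two resulting halves. *)
Lemma is_derive_quadratic (R : realType) (d : nat) (Q : 'M[R]_d)
    (g : R -> 'rV[R]_d) (p v : 'rV[R]_d) (s : R) :
  Q^T = Q -> is_derive s 1 g v ->
  is_derive s 1 (fun t => edot ((g t - p) *m Q) (g t - p))
    (2 * edot (v *m Q) (g s - p)).
Proof.
move=> Qsym gv.
have wv : is_derive s 1 (fun t => g t - p) v.
  have := is_deriveB gv (is_derive_cst p s 1).
  by rewrite subr0.
set w := fun t => g t - p; rewrite -[g s - p]/(w s).
have E (x y : 'rV[R]_d) : edot (x *m Q) y = \sum_i edot x (row i Q) * y 0 i.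
  apply: eq_bigr => i _; rewrite mxE; congr (_ * _).
  by apply: eq_bigr => j _; rewrite mxE -[in RHS]Qsym mxE.
have -> : (fun t => edot ((g t - p) *m Q) (g t - p)) =
    \sum_i (fun t : R => edot (w t) (row i Q) * w t 0 i).
  by apply/funext => t; rewrite fct_sumE E.
have -> : 2 * edot (v *m Q) (w s) =
    \sum_i (edot (w s) (row i Q) * v 0 i + w s 0 i * edot v (row i Q)).
  rewrite big_split/= -E mulr2n mulrDl mul1r; congr (_ + _).
    by rewrite edot_mulmx Qsym edotC.
  by rewrite E; apply: eq_bigr => i _; rewrite mulrC.
have H := @is_derive_sum R R R d (fun i t => edot (w t) (row i Q) * w t 0 i) s 1
  (fun i => edot (w s) (row i Q) * v 0 i + w s 0 i * edot v (row i Q)).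
apply H => i.
exact: (is_deriveM (is_derive_edot (row i Q) wv) (is_derive_coord i wv)).
Qed.

Section flow.
Variables (R : realType) (d : nat) (M : set 'rV[R]_d).
Variables (phi : R -> 'rV[R]_d -> 'rV[R]_d) (X : 'rV[R]_d -> 'rV[R]_d).
Hypotheses (flow : flow_on M phi) (vel : velocity_field M phi X).
Local Notation N := (@eucl_norm R d).

Let phi_in t x : M x -> M (phi t x). Proof. by case: flow => + _ _ _; apply. Qed.
Let phi0 x : M x -> phi 0 x = x. Proof. by case: flow => _ + _ _; apply. Qed.
Let phiD s t x : M x -> phi (s + t) x = phi s (phi t x).
Proof. by case: flow => _ _ + _; apply. Qed.

(** The group law carries the velocity at time 0 to any time. The factor [e], later 1 or -1, treats
    forward and backward arcs at once. *)
Lemma flow_derive (e t : R) (x : 'rV[R]_d) : M x ->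
  is_derive t 1 (fun s => phi (e * s) x) (e *: X (phi (e * t) x)).
Proof.
move=> Mx.
have H0 : is_derive (0 : R) 1 (fun s => phi s (phi (e * t) x)) (X (phi (e * t) x)).
  exact: (vel (phi_in _ Mx)).
have H1 := is_derive1_dir e H0.
(* The base point is 0 in disguise: the affine time [s * e - e * t] vanishes at [s = t]. *)
have H2 : is_derive (t *: e + - (e * t)) e (fun s => phi s (phi (e * t) x))
    (e *: X (phi (e * t) x)).
  by rewrite [t *: e]mulrC subrr.
have := is_derive_line H2; congr is_derive.
by apply/funext => s; rewrite -phiD// subrK [s *: e]mulrC.
Qed.

Section local_lipschitz.
Variables (p : 'rV[R]_d) (r L : R).
Hypotheses (Mp : M p) (r_gt0 : 0 < r) (L_gt0 : 0 < L).
Hypothesis XL : forall x y, M x -> M y -> N (x - p) < r -> N (y - p) < r ->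
  N (X y - X x) <= L * N (y - x).

(** The curve [s |-> phi (e * s) x] has velocity [e *: X], so the Lipschitz bound on [X] is what the
    two short arc lemmas ask for. *)
Lemma flow_short_arc (e tau : R) (x : 'rV[R]_d) : M x -> `|e| = 1 ->
  0 <= tau -> L * tau <= 4^-1 ->
  (forall s, s \in `[0, tau]%R -> N (phi (e * s) x - p) < r) ->
  forall s, s \in `[0, tau]%R ->
    N (phi (e * s) x - x) <= 4 / 3 * tau * N (X x) /\
    N (phi (e * s) x - x) <= N (phi (e * tau) x - x).
Proof.
move=> Mx e1 tau_ge0 Ltau arc s s_in.
have phix : phi (e * 0) x = x by rewrite mulr0 phi0.
have g'L t : t \in `[0, tau]%R ->
    N (e *: X (phi (e * t) x) - e *: X (phi (e * 0) x)) <=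
    L * N (phi (e * t) x - phi (e * 0) x).
  move=> t_in; rewrite -scalerBr enormZ e1 mul1r phix.
  apply: XL => //; rewrite ?arc//; first exact: phi_in.
  by rewrite -phix arc// in_itv/= lexx.
have gg' t : t \in `[0, tau]%R -> is_derive t 1 (fun s => phi (e * s) x)
    (e *: X (phi (e * t) x)) by move=> _; exact: flow_derive.
have := short_arc_bound tau_ge0 (ltW L_gt0) Ltau gg' g'L s_in.
have := short_arc_monotone tau_ge0 (ltW L_gt0) Ltau gg' g'L s_in.
by rewrite enormZ e1 mul1r phix.
Qed.

(** This stands in for uniqueness of solutions: for short times the displacement is bounded by a
    multiple of [N (X p) = 0]. Longer times are iterates of short ones, and negative times follow by
    inversion. *)
Lemma zero_fixed : X p = 0 -> fix_points M phi p.
Proof.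
move=> Xp0; split=> //.
have [eta eta_gt0 near_p] : exists2 eta : R, 0 < eta &
    forall s, `|s| < eta -> N (phi s p - p) < r.
  have cont : {for (0 : R), continuous (fun s => phi s p)}.
    have [dphi _] : is_derive (0 : R) 1 (fun s => phi s p) (X p) by exact: vel.
    exact/differentiable_continuous/derivable1_diffP.
  have : \forall s \near (0 : R), N (phi s p - p) < r.
    by apply: (cont [set y | N (y - p) < r]); rewrite /= phi0//; exact: eball_nbhs.
  move=> /nbhs_ballP[eta /= eta_gt0 H]; exists eta => // s s_eta; apply: H.
  by rewrite /ball/= sub0r normrN.
pose tau := Num.min (eta / 2) (4 * L)^-1.
have tau_gt0 : 0 < tau by rewrite lt_min divr_gt0//= invr_gt0 mulr_gt0.
have Ltau : L * tau <= 4^-1.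
  by rewrite -ler_pdivlMl// mulrC -invfM ge_min lexx orbT.
have small s : 0 <= s <= tau -> phi s p = p.
  move=> s_in; apply/eqP; rewrite -subr_eq0; apply/eqP/enorm_eq0.
  apply/eqP; rewrite eq_le enorm_ge0 andbT.
  have [] := @flow_short_arc 1 tau p Mp (normr1 _) (ltW tau_gt0) Ltau _ s.
  - move=> t; rewrite in_itv/= mul1r => /andP[t0 t_tau]; apply: near_p.
    rewrite ger0_norm//; apply: le_lt_trans t_tau _.
    by rewrite gt_min ltr_pdivrMr// ltr_pMr// ltr1n.
  - by rewrite in_itv.
  - by rewrite mul1r Xp0 enorm0 mulr0.
have nonneg t : 0 <= t -> phi t p = p.
  move=> t_ge0.
  (* The successor makes [n] nonzero and larger than [t / tau], so that each step [t / n] is at most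
     [tau]. *)
  pose n := (Num.truncn (t / tau)).+1.
  have -> : t = (t / n%:R) *+ n by rewrite -mulr_natr divfK// pnatr_eq0.
  have : phi (t / n%:R) p = p.
    apply: small; rewrite divr_ge0//= ler_pdivrMr// mulrC -ler_pdivrMr//.
    by rewrite ltW// real_truncnS_gt// num_real.
  move: (t / n%:R) => s ps; elim: (n) => [|m IH]; first by rewrite mulr0n phi0.
  by rewrite mulrS phiD// IH.
move=> t; have [t0|t0] := leP 0 t; first exact: nonneg.
rewrite -{1}(nonneg (- t)) ?oppr_ge0 ?(ltW t0)//.
by rewrite -phiD// subrr phi0.
Qed.

(* Along an orbit near [p] the linear function [edot _ (X p)] is strictly
   monotone. *)
Lemma return_time_regular (T : R) : X p != 0 -> 0 < T ->
  exists (r' c : R), [/\ 0 < r', r' <= r, 0 < c &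
    forall (x : 'rV[R]_d) (e tau delta : R), M x -> `|e| = 1 -> 0 <= tau ->
      (forall s, s \in `[0, tau]%R -> N (phi (e * s) x - p) < r') ->
      0 < delta < c -> N (phi (e * tau) x - x) < delta * N (X x) -> tau <= T].
Proof.
move=> Xp_neq0 T_gt0; set n := N (X p).
have n_gt0 : 0 < n.
  rewrite lt0r enorm_ge0 andbT; apply: contra Xp_neq0 => /eqP/enorm_eq0 ->.
  by rewrite eqxx.
(* Within [n / (2 * L)] of [p], [X] differs from [X p] by at most [n / 2]. Then [n ^+ 2 / 2 * tau <=
   delta * (3 / 2 * n) * n], that is [tau <= 3 * delta], whence [T / 3]. *)
exists (Num.min r (n / (2 * L))), (T / 3); split.
- by rewrite lt_min r_gt0 divr_gt0// mulr_gt0.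
- by rewrite ge_min lexx.
- by rewrite divr_gt0.
move=> x e tau delta Mx e1 tau_ge0 arc /andP[delta_gt0 delta_lt] return_x.
have near_p y : M y -> N (y - p) < Num.min r (n / (2 * L)) ->
    N (X y - X p) <= n / 2.
  move=> My; rewrite lt_min ltr_pdivlMr ?mulr_gt0// => /andP[yr yn].
  have := XL Mp My; rewrite subrr enorm0 => /(_ r_gt0 yr)/le_trans; apply.
  lra.
have phix : phi (e * 0) x = x by rewrite mulr0 phi0.
have xr : N (x - p) < Num.min r (n / (2 * L)).
  by rewrite -phix arc// in_itv/= lexx.
have Xx : N (X x) <= 3 / 2 * n.
  have := enormD (X x - X p) (X p); rewrite subrK -/n.
  have := near_p x Mx xr; lra.
have [s s_in] := MVT_closed tau_ge0
  (fun s _ => is_derive_edot (X p) (flow_derive e s Mx)).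
rewrite phix -edotBl subr0 edotZl => hs.
have lower : n ^+ 2 / 2 <= edot (X (phi (e * s) x)) (X p).
  rewrite -(subrK (X p) (X (phi _ _))) edotDl -sqr_enorm -/n.
  have := cauchy_schwarz (X (phi (e * s) x) - X p) (X p).
  rewrite ler_norml => /andP[+ _].
  have : N (X (phi (e * s) x) - X p) * n <= n / 2 * n.
    by rewrite ler_wpM2r ?(ltW n_gt0)// near_p ?arc//; exact: phi_in.
  rewrite -/n; lra.
have upper : n ^+ 2 / 2 * tau <= N (phi (e * tau) x - x) * n.
  apply: le_trans (cauchy_schwarz _ _); rewrite hs !normrM e1 mul1r.
  rewrite (ger0_norm tau_ge0) ler_wpM2r//.
  exact: le_trans lower (ler_norm _).
have : N (phi (e * tau) x - x) * n <= T / 3 * (3 / 2 * n) * n.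
  rewrite ler_wpM2r ?(ltW n_gt0)//; apply: le_trans (ltW return_x) _.
  by apply: ler_pM; rewrite ?enorm_ge0// ltW.
move=> /(le_trans upper).
rewrite (_ : _ / 3 * _ * _ = n ^+ 2 / 2 * T); last by field.
by rewrite ler_pM2l// divr_gt0// exprn_gt0.
Qed.

(* Along an orbit near [p] the quadratic form [Q] centred at [p] is strictly
   monotone, with a derivative comparable to the squared distance to [p]. *)
Lemma return_time_hyperbolic (Q : 'M[R]_d) (c0 r0 T : R) :
  X p = 0 -> Q^T = Q -> 0 < c0 -> 0 < r0 ->
  (forall y, M y -> N (y - p) < r0 ->
    c0 * N (y - p) ^+ 2 <= edot (X y *m Q) (y - p)) ->
  0 < T -> L * T <= 4^-1 ->
  exists (r' c : R), [/\ 0 < r', r' <= r, 0 < c &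
    forall (x : 'rV[R]_d) (e tau delta : R), M x -> `|e| = 1 -> 0 <= tau ->
      (forall s, s \in `[0, tau]%R -> N (phi (e * s) x - p) < r') ->
      0 < delta < c -> N (phi (e * tau) x - x) < delta * N (X x) -> tau <= T].
Proof.
move=> Xp0 Qsym c0_gt0 r0_gt0 form T_gt0 LT.
have [K K_gt0 KQ] := mulmx_enorm_le Q.
have c1_gt0 : 0 < c0 * T / (6 * K * L) by rewrite divr_gt0 ?mulr_gt0.
(* [delta < L^-1] keeps the end point within [2 * n] of [p], where [n] is the distance from [x] to
   [p]. The second threshold is where the growth [c0 * T / 2 * n ^+ 2] meets the upper bound
   [3 * K * delta * L * n ^+ 2]. *)
exists (Num.min r r0), (Num.min L^-1 (c0 * T / (6 * K * L))); split.
- by rewrite lt_min r_gt0.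
- by rewrite ge_min lexx.
- by rewrite lt_min invr_gt0 L_gt0.
move=> x e tau delta Mx e1 tau_ge0 arc.
rewrite lt_min => /and3P[delta_gt0 delta_L delta_c] return_x.
rewrite leNgt; apply/negP => T_tau.
have phix : phi (e * 0) x = x by rewrite mulr0 phi0.
have arc_r s : s \in `[0, tau]%R -> N (phi (e * s) x - p) < r.
  by move=> /arc; rewrite lt_min => /andP[].
have xr : N (x - p) < r by rewrite -phix arc_r// in_itv/= lexx.
have Xx : N (X x) <= L * N (x - p).
  by have := XL Mp Mx; rewrite subrr enorm0 Xp0 subr0 => /(_ r_gt0 xr).
set n := N (x - p) in Xx *.
(* The strict return inequality excludes [X x = 0], hence [x = p]; the final comparison can then be
   divided by [n ^+ 2]. *)
have Xx_gt0 : 0 < N (X x).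
  by rewrite -(pmulr_rgt0 _ delta_gt0); exact: le_lt_trans (enorm_ge0 _) return_x.
have n_gt0 : 0 < n by rewrite -(pmulr_rgt0 _ L_gt0); exact: lt_le_trans Xx.
pose V (y : 'rV[R]_d) := edot ((y - p) *m Q) (y - p).
(* With the factor [e], and [e ^+ 2 = 1], [h] increases along the arc in either direction of
   time. *)
pose h (s : R) : R := e * V (phi (e * s) x).
pose h' (s : R) : R := 2 * edot (X (phi (e * s) x) *m Q) (phi (e * s) x - p).
have dh (s : R) : is_derive s 1 h (h' s).
  have := is_derive_quadratic p Qsym (flow_derive e s Mx) => dV.
  have := is_deriveZ e dV; rewrite /h /h' => H; apply: (is_derive_eq H).
  rewrite -scalemxAl edotZl; set E := edot _ _.
  rewrite [LHS](_ : _ = e ^+ 2 * (2 * E)); last first.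
    by change (e * (2 * (e * E)) = e ^+ 2 * (2 * E)); ring.
  by rewrite -[e ^+ 2]real_normK ?num_real// e1 expr1n mul1r.
have h'_ge s : s \in `[0, tau]%R -> 2 * c0 * N (phi (e * s) x - p) ^+ 2 <= h' s.
  move=> s_in; rewrite /h' -mulrA ler_pM2l//; apply: form; first exact: phi_in.
  by have := arc s s_in; rewrite lt_min => /andP[].
(* On [[0, T]] the growth of [h] is quantitative, since the orbit stays at distance at least [n / 2]
   from [p]; on [[T, tau]] only its sign is kept. *)
have [s1 s1_in hs1] := MVT_closed (ltW T_gt0) (fun s _ => dh s).
have [s2 s2_in hs2] := MVT_closed (ltW T_tau) (fun s _ => dh s).
have T_sub s : s \in `[0, T]%R -> s \in `[0, tau]%R.
  by rewrite !in_itv/= => /andP[-> /le_trans]; apply; exact: ltW.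
have s2_in' : s2 \in `[0, tau]%R.
  move: s2_in; rewrite !in_itv/= => /andP[Ts2 ->]; rewrite andbT.
  exact: le_trans (ltW T_gt0) Ts2.
have hs2_ge0 : 0 <= h tau - h T.
  rewrite hs2 mulr_ge0 ?subr_ge0 ?(ltW T_tau)//; apply: le_trans (h'_ge _ s2_in').
  by rewrite mulr_ge0 ?sqr_ge0// mulr_ge0// ltW.
have [near_x _] := flow_short_arc Mx e1 (ltW T_gt0) LT
  (fun s sT => arc_r s (T_sub s sT)) s1_in.
(* Up to time [T] the orbit moves by at most [4 / 3 * T * L * n <= n / 3]. *)
have far_p : n / 2 <= N (phi (e * s1) x - p).
  have := enormB (phi (e * s1) x - p) (phi (e * s1) x - x).
  rewrite [_ - p - _](_ : _ = x - p); last by rewrite opprB addrC subrKA.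
  rewrite -/n.
  have : 4 / 3 * T * N (X x) <= 4 / 3 * T * (L * n).
    by rewrite ler_wpM2l// mulr_ge0 ?(ltW T_gt0).
  have : L * T * n <= 4^-1 * n by rewrite ler_wpM2r ?(ltW n_gt0).
  lra.
have lower : c0 * T / 2 * n ^+ 2 <= h tau - h 0.
  rewrite -(subrKA (h T)); apply: (@le_trans _ _ (h T - h 0)); last by rewrite lerDr.
  rewrite hs1 subr0 [leLHS](_ : _ = 2 * c0 * (n / 2) ^+ 2 * T); last by field.
  rewrite ler_pM2r//; apply: le_trans (h'_ge _ (T_sub _ s1_in)).
  by rewrite ler_pM2l ?mulr_gt0// ler_pXn2r ?nnegrE ?enorm_ge0// divr_ge0// ltW.
set y := phi (e * tau) x in return_x.
have yx : N (y - x) <= delta * (L * n).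
  by apply: le_trans (ltW return_x) _; rewrite ler_pM2l.
have yp : N (y - p) <= 2 * n.
  have := enormD (y - x) (x - p); rewrite subrKA -/n.
  have : delta * (L * n) <= n.
    by rewrite mulrA -[leRHS]mul1r ler_pM2r// -ler_pdivlMr// mul1r ltW.
  lra.
have upper : h tau - h 0 <= K * (delta * (L * n)) * (3 * n).
  rewrite /h -mulrBr phix -/y; apply: le_trans (ler_norm _) _.
  rewrite normrM e1 mul1r.
  (* A difference of squares for the symmetric form [Q]; the distances [2 * n] and [n] of [y] and
     [x] to [p] produce the factor [3 * n]. *)
  have -> : V y - V x = edot ((y - x) *m Q) (y - p) + edot ((y - x) *m Q) (x - p).
    have sym : edot ((x - p) *m Q) (y - p) = edot ((y - p) *m Q) (x - p).
      by rewrite edot_mulmx Qsym edotC.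
    rewrite (_ : y - x = (y - p) - (x - p)); last by rewrite opprB addrA subrK.
    by rewrite mulmxBl !edotBl sym /V; ring.
  have bnd z m : N (z - p) <= m ->
      `|edot ((y - x) *m Q) (z - p)| <= K * (delta * (L * n)) * m.
    move=> zm; apply: le_trans (cauchy_schwarz _ _) _.
    apply: ler_pM; rewrite ?enorm_ge0//; apply: le_trans (KQ _) _.
    by rewrite ler_pM2l.
  apply: le_trans (ler_normD _ _) _.
  have := bnd y _ yp; have := bnd x n (lexx _); lra.
have := le_trans lower upper; apply/negP; rewrite -ltNge.
rewrite [ltLHS](_ : _ = delta * (6 * K * L) * (n ^+ 2 / 2)); last by field.
rewrite [ltRHS](_ : _ = c0 * T * (n ^+ 2 / 2)); last by field.
by rewrite ltr_pM2r ?divr_gt0 ?exprn_gt0// -ltr_pdivlMr// !mulr_gt0.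
Qed.

End local_lipschitz.
End flow.

(** * From return times to efficiency, by compactness *)

Section efficiency.
Variables (R : realType) (d k : nat) (M : set 'rV[R]_d).
Variables (phi : R -> 'rV[R]_d -> 'rV[R]_d) (X : 'rV[R]_d -> 'rV[R]_d).
Hypotheses (Mm : C2_manifold k M) (flow : flow_on M phi).
Hypotheses (vel : velocity_field M phi X) (XC1 : C1_on_manifold M X).
Hypothesis hyp : forall s, fix_points M phi s -> hyperbolic M X s.
Local Notation N := (@eucl_norm R d).

(** Either [X p] is nonzero, or [p] is a fixed point and hence hyperbolic. In both cases the return
    time is at most [T = (4 * L)^-1], so by [flow_short_arc] no point of the arc is farther from [x]
    than its end point. *)
Lemma local_efficiency p : M p ->
  exists (r c : R), [/\ 0 < r, 0 < c &
    forall (x : 'rV[R]_d) (e tau delta : R), M x -> `|e| = 1 -> 0 <= tau ->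
      (forall s, s \in `[0, tau]%R -> N (phi (e * s) x - p) < r) ->
      0 < delta < c -> N (phi (e * tau) x - x) < delta * N (X x) ->
      forall s, s \in `[0, tau]%R -> N (phi (e * s) x - x) < delta * N (X x)].
Proof.
move=> Mp; have [F [U [oU Up CF FX]]] := XC1 Mp.
have [r [L0 [r_gt0 L0_ge0 rU FL]]] := C1_lipschitz oU Up CF.
pose L := L0 + 1; have L_gt0 : 0 < L by rewrite ltr_wpDl.
have XL x y : M x -> M y -> N (x - p) < r -> N (y - p) < r ->
    N (X y - X x) <= L * N (y - x).
  move=> Mx My xr yr; rewrite -!FX//; [|exact: rU|exact: rU].
  by apply: le_trans (FL _ _ xr yr) _; rewrite mulrDl mul1r lerDl enorm_ge0.
pose T := (4 * L)^-1; have T_gt0 : 0 < T by rewrite invr_gt0 mulr_gt0.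
have LT : L * T <= 4^-1.
  by rewrite /T invfM mulrCA divff ?mulr1// gt_eqF.
suff [r' [c [r'_gt0 r'r c_gt0 tauT]]] : exists (r' c : R),
    [/\ 0 < r', r' <= r, 0 < c &
    forall (x : 'rV[R]_d) (e tau delta : R), M x -> `|e| = 1 -> 0 <= tau ->
      (forall s, s \in `[0, tau]%R -> N (phi (e * s) x - p) < r') ->
      0 < delta < c -> N (phi (e * tau) x - x) < delta * N (X x) -> tau <= T].
  exists r', c; split=> // x e tau delta Mx e1 tau_ge0 arc delta_c ret s s_in.
  apply: le_lt_trans (ret).
  have Ltau : L * tau <= 4^-1.
    apply: le_trans LT; rewrite ler_pM2l//.
    exact: tauT Mx e1 tau_ge0 arc delta_c ret.
  have arc_r t : t \in `[0, tau]%R -> N (phi (e * t) x - p) < r.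
    by move=> /arc/lt_le_trans; apply.
  by have [] := flow_short_arc flow vel L_gt0 XL Mx e1 tau_ge0 Ltau arc_r s_in.
have [Xp0|Xp_neq0] := eqVneq (X p) 0; last first.
  exact: (return_time_regular flow vel Mp r_gt0 L_gt0 XL).
have fixp := zero_fixed flow vel Mp r_gt0 L_gt0 XL Xp0.
have [Q [c0 [r0 [Qsym c0_gt0 r0_gt0 form]]]] := hyperbolic_form Mm Mp Xp0 (hyp fixp).
exact: (return_time_hyperbolic flow vel Mp r_gt0 L_gt0 XL
  Xp0 Qsym c0_gt0 r0_gt0 form).
Qed.

End efficiency.

Theorem corollary3p11 (R : realType) (d k : nat) (M : set 'rV[R]_d)
    (phi : R -> 'rV[R]_d -> 'rV[R]_d) (X : 'rV[R]_d -> 'rV[R]_d) :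
  C2_manifold k M -> compact M ->
  flow_on M phi -> velocity_field M phi X -> C1_on_manifold M X ->
  (forall s, fix_points M phi s -> hyperbolic M X s) ->
  efficient M phi X.
Proof.
move=> Mm /compact_near_coveringP Mcov flow vel XC1 hyp.
have [phi_in phi0 phiD _] := flow.
pose N := @eucl_norm R d.
(* Here the arc is measured from its own starting point instead of a centre [p], and [b] bounds both
   the arc and [delta], so that one [b] can serve all of [M]. *)
pose P (b : R) (x : 'rV[R]_d) := forall (e tau delta : R),
  M x -> `|e| = 1 -> 0 <= tau -> 0 < delta < b ->
  (forall s, s \in `[0, tau]%R -> N (phi (e * s) x - x) < b) ->
  N (phi (e * tau) x - x) < delta * N (X x) ->
  forall s, s \in `[0, tau]%R -> N (phi (e * s) x - x) < delta * N (X x).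
have Pnear : \forall b \near 0^'+, M `<=` P b.
  apply: Mcov => p Mp.
  have [r [c [r_gt0 c_gt0 loc]]] := local_efficiency Mm flow vel XC1 hyp Mp.
  have r2_gt0 : 0 < r / 2 by rewrite divr_gt0.
  (* Halving the radius: a start within [r / 2] of [p] and an arc within [r / 2] of its start stay
     in the ball of radius [r]. *)
  exists ([set x | N (x - p) < r / 2], [set b : R | b < Num.min (r / 2) c]) => /=.
    split; first exact: eball_nbhs.
    by apply: nbhs_right_lt; rewrite lt_min r2_gt0.
  move=> [x b] /= [xr]; rewrite lt_min => /andP[br bc].
  move=> e tau delta Mx e1 tau_ge0 /andP[delta_gt0 delta_b] arc.
  apply: loc => //; last by rewrite delta_gt0 (lt_trans delta_b).
  move=> s /arc sb.
  rewrite -(subrKA x) (le_lt_trans (enormD _ _))//.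
  rewrite -/N; have := lt_trans sb br; lra.
have [b [b_gt0 Pb]] : exists b : R, 0 < b /\ M `<=` P b.
  have : \forall b \near (0 : R)^'+, 0 < b /\ M `<=` P b.
    by apply: filterI => //; exact: nbhs_right_gt.
  by move=> /filter_ex.
exists b => // delta x g delta_b [Mx _] _ ret diam t y [s s_in <-].
have Mt := phi_in t _ Mx.
(* The arc from time [t] to [g t] has direction [e] and time length [|u|], which covers both orders
   of [t] and [g t]. *)
pose u := g t - t; pose e : R := if 0 <= u then 1 else -1.
have e1 : `|e| = 1 by rewrite /e; case: ifP; rewrite ?normrN normr1.
have ue : u = e * `|u|.
  by rewrite /e; case: ger0P => _; rewrite ?mul1r ?mulN1r ?opprK.
have ee : e * e = 1 by rewrite /e; case: ifP; rewrite ?mulrNN mulr1.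
have flowE a : phi (e * a) (phi t x) = phi (t + e * a) x by rewrite addrC phiD.
have in_arc a : a \in `[0, `|u|]%R -> orbit_arc phi t (g t) x (phi (t + e * a) x).
  move=> a_in; exists (t + e * a) => //; move: a_in.
  rewrite /= !in_itv/= ge_min le_max /e /u => /andP[].
  by case: (ger0P (g t - t)) => h a0 au; apply/andP; split; apply/orP;
    [left|right|right|left]; lra.
have arc a : a \in `[0, `|u|]%R -> N (phi (e * a) (phi t x) - phi t x) < b.
  move=> a_in; rewrite flowE -lte_fin; apply: le_lt_trans (diam t).
  apply: ereal_sup_ubound; exists (phi t x), (phi (t + e * a) x); split=> //.
    by have := in_arc 0; rewrite mulr0 addr0; apply; rewrite in_itv/= lexx normr_ge0.
  exact: in_arc.
have back : N (phi (e * `|u|) (phi t x) - phi t x) < delta * N (X (phi t x)).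
  by rewrite flowE -ue /u subrKC; exact: ret.
(* As [e * e = 1], [e * (s - t)] is the parameter at which the arc passes through the chosen point
   [phi s x]. *)
have a_in : e * (s - t) \in `[0, `|u|]%R.
  move: s_in; rewrite /= !in_itv/= ge_min le_max /e /u => /andP[].
  by case: (ger0P (g t - t)) => h /orP[] h1 /orP[] h2; apply/andP; split; lra.
have := Pb _ Mt e `|u| delta Mt e1 (normr_ge0 _) delta_b arc back _ a_in.
by rewrite flowE mulrA ee mul1r subrKC.
Qed.
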